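(* Let $X=\{0,1\}$ and let $a,b$ be the automorphisms of the binary rooted tree $X^*$ defined by the wreath recursion $a=(b,a)\sigma$, $b=(b,a)$, where $\sigma$ is the transposition of $X$. Let $T_{\langle a\rangle}$ and $T_{\langle b\rangle}$ be the orbit trees of the actions of the cyclic groups $\langle a\rangle$ and $\langle b\rangle$ on $X^*$. Then: (a) In the orbit tree $T_{\langle a\rangle}$ all vertices on levels $2^n-1$, $n\ge0$, have one child and all vertices on all other levels have two children. The space of ergodic components of the action of $\langle a\rangle$ on $X^\omega$ is homeomorphic to the Cantor set. (b) The orbit tree $T_{\langle b\rangle}$ is recursively obtained by declaring that the root has two children, which are the roots of (subtrees isomorphic to) the trees $T_{\langle b\rangle}$ and $T_{\langle a\rangle}$, respectively. The space of ergodic components of the action of $\langle b\rangle$ on $X^\omega$ is again homeomorphic to the Cantor set.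
   Context: $X^*$ is the set of finite words over $X$, viewed as the binary rooted tree: the root is the empty word and $v$ is adjacent to $vx$ for $v\in X^*$, $x\in X$; words of length $n$ form level $n$. The set $X^\omega$ of infinite words is its boundary, with the product topology. The wreath recursion $g=(g_0,g_1)\lambda$ with $\lambda\in\mathrm{Sym}(X)$ means $g(xv)=\lambda(x)\,g_x(v)$ for $x\in X$ and any finite or infinite word $v$ ($\lambda$ omitted means trivial). Thus $a(0v)=1b(v)$, $a(1v)=0a(v)$, $b(0v)=0b(v)$, $b(1v)=1a(v)$. (The group generated by $a,b$ is the lamplighter group.) For a group $G$ acting by automorphisms on a rooted tree $T$, the orbit tree $T_G$ is the graph whose vertices are the orbits of $G$ on the levels of $T$, two orbits being adjacent iff they contain vertices adjacent in $T$; it is a rooted tree with root the orbit of the root of $T$. The children of a level $n$ vertex are the level $n+1$ vertices adjacent to it. The space of ergodic components of the action of $G$ on $\partial T$ is the space $\mathcal{M}^e_G$ of ergodic $G$-invariant Borel probability measures on $\partial T$ with the weak topology ($\mu_n\to\mu$ iff $\int f\,d\mu_n\to\int f\,d\mu$ for all bounded continuous $f$), where an invariant probability measure is ergodic if every $G$-invariant Borel set has measure $0$ or $1$. *)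

(* Defs.v *)
From HB Require Import structures.
From Stdlib Require Import Relation_Operators.
From mathcomp Require Import all_boot all_order all_algebra.
From mathcomp Require Import all_classical all_reals all_analysis.

Set Implicit Arguments.
Unset Strict Implicit.
Unset Printing Implicit Defensive.

Import Order.TTheory GRing.Theory Num.Theory.
Import numFieldNormedType.Exports.

Local Open Scope classical_set_scope.

(* The alphabet is X = {0, 1} = {false, true}; the head of a word is its first
   letter. *)
Definition word := seq bool.

Definition word_adj (u v : word) : Prop :=
  exists x : bool, v = rcons u x \/ u = rcons v x.

Record tree_aut := TreeAut {
  aut_fun :> word -> word;
  aut_inv : word -> word;
  aut_funK : cancel aut_fun aut_inv;
  aut_invK : cancel aut_inv aut_fun;
  aut_root : aut_fun [::] = [::];
  aut_adj : forall u v, word_adj (aut_fun u) (aut_fun v) <-> word_adj u v }.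

Lemma tree_aut_ext (g h : tree_aut) : g =1 h -> g = h.
Proof.
case: g h => [f f' fK f'K f0 fa] [k k' kK k'K k0 ka] /= fk.
have {}fk : f = k by apply/funext.
subst k; have f'k' : f' = k'.
  by apply/funext => w; rewrite -{1}(k'K w) fK.
subst k'; congr TreeAut; exact: Prop_irrelevance.
Qed.

Definition aut_one : tree_aut :=
  @TreeAut id id (fun=> erefl) (fun=> erefl) erefl (fun _ _ => conj id id).

Definition aut_mul (g h : tree_aut) : tree_aut.
Proof.
refine (@TreeAut (g \o h) (aut_inv h \o aut_inv g) _ _ _ _).
- exact: can_comp (@aut_funK g) (@aut_funK h).
- exact: can_comp (@aut_invK h) (@aut_invK g).
- by rewrite /= !aut_root.
- by move=> u v; rewrite /= !aut_adj.
Defined.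

Definition aut_opp (g : tree_aut) : tree_aut.
Proof.
refine (@TreeAut (aut_inv g) g (@aut_invK g) (@aut_funK g) _ _).
- by rewrite -[in LHS](aut_root g) aut_funK.
- by move=> u v; rewrite -(aut_adj g) !aut_invK.
Defined.

HB.instance Definition _ := gen_eqMixin tree_aut.
HB.instance Definition _ := gen_choiceMixin tree_aut.

Fact aut_mulA : associative aut_mul.
Proof. by move=> g h k; apply: tree_aut_ext. Qed.
Fact aut_mul1 : left_id aut_one aut_mul.
Proof. by move=> g; apply: tree_aut_ext. Qed.
Fact aut_1mul : right_id aut_one aut_mul.
Proof. by move=> g; apply: tree_aut_ext. Qed.
Fact aut_mulV : left_inverse aut_one aut_opp aut_mul.
Proof. by move=> g; apply: tree_aut_ext => w /=; rewrite aut_funK. Qed.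
Fact aut_Vmul : right_inverse aut_one aut_opp aut_mul.
Proof. by move=> g; apply: tree_aut_ext => w /=; rewrite aut_invK. Qed.

HB.instance Definition _ := isGroup.Build tree_aut
  aut_mulA aut_mul1 aut_1mul aut_mulV aut_Vmul.

Definition cyclic_gen (g : tree_aut) : set tree_aut :=
  [set h | exists n : nat, h = (g ^+ n)%g \/ h = (g ^- n)%g].

(* Infinite words are the points of [cantor_space], which is [nat -> bool] with
   the product topology; an automorphism acts on them through prefixes. *)
Definition boundary_act (g : tree_aut) (w : cantor_space) : cantor_space :=
  fun n => nth false (g (mkseq w n.+1)) n.

(* a = (b, a) sigma and b = (b, a) *)
Fixpoint a_fun (w : word) : word :=
  match w with
  | [::] => [::]
  | false :: v => true :: b_fun v
  | true :: v => false :: a_fun v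
  end
with b_fun (w : word) : word :=
  match w with
  | [::] => [::]
  | false :: v => false :: b_fun v
  | true :: v => true :: a_fun v
  end.

Fixpoint a_inv (w : word) : word :=
  match w with
  | [::] => [::]
  | true :: v => false :: b_inv v
  | false :: v => true :: a_inv v
  end
with b_inv (w : word) : word :=
  match w with
  | [::] => [::]
  | false :: v => false :: b_inv v
  | true :: v => true :: a_inv v
  end.

Lemma ab_funK : cancel a_fun a_inv /\ cancel b_fun b_inv.
Proof.
suff H w : a_inv (a_fun w) = w /\ b_inv (b_fun w) = w by split=> w; case: (H w).
by elim: w => [//|[] v [IHa IHb]] /=; rewrite ?IHa ?IHb.
Qed.

Lemma ab_invK : cancel a_inv a_fun /\ cancel b_inv b_fun.
Proof.
suff H w : a_fun (a_inv w) = w /\ b_fun (b_inv w) = w by split=> w; case: (H w).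
by elim: w => [//|[] v [IHa IHb]] /=; rewrite ?IHa ?IHb.
Qed.

Definition extends_prefixes (f : word -> word) : Prop :=
  forall v x, exists y, f (rcons v x) = rcons (f v) y.

Lemma ab_fun_prefix : extends_prefixes a_fun /\ extends_prefixes b_fun.
Proof.
suff H v x : (exists y, a_fun (rcons v x) = rcons (a_fun v) y) /\
             (exists y, b_fun (rcons v x) = rcons (b_fun v) y).
  by split=> v x; case: (H v x).
elim: v => [|[] v [[y IHa] [z IHb]]] /=.
- by case: x; split; eexists.
- by split; exists y; rewrite IHa.
- by split; exists z; rewrite IHb.
Qed.

Lemma ab_inv_prefix : extends_prefixes a_inv /\ extends_prefixes b_inv.
Proof.
suff H v x : (exists y, a_inv (rcons v x) = rcons (a_inv v) y) /\
             (exists y, b_inv (rcons v x) = rcons (b_inv v) y).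
  by split=> v x; case: (H v x).
elim: v => [|[] v [[y IHa] [z IHb]]] /=.
- by case: x; split; eexists.
- by split; [exists z; rewrite IHb | exists y; rewrite IHa].
- by split; [exists y; rewrite IHa | exists z; rewrite IHb].
Qed.

Lemma extends_prefixes_adj (f f' : word -> word) :
  cancel f f' -> extends_prefixes f -> extends_prefixes f' ->
  forall u v, word_adj (f u) (f v) <-> word_adj u v.
Proof.
move=> fK fp f'p.
have mono g : extends_prefixes g ->
    forall u v, word_adj u v -> word_adj (g u) (g v).
  move=> gp u v [x [->|->]].
  - by have [y ->] := gp u x; exists y; left.
  - by have [y ->] := gp v x; exists y; right.
move=> u v; split; last exact: mono.
by move=> /(mono _ f'p); rewrite !fK.
Qed.

Definition a_aut : tree_aut :=
  TreeAut ab_funK.1 ab_invK.1 erefl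
    (extends_prefixes_adj ab_funK.1 ab_fun_prefix.1 ab_inv_prefix.1).

Definition b_aut : tree_aut :=
  TreeAut ab_funK.2 ab_invK.2 erefl
    (extends_prefixes_adj ab_funK.2 ab_fun_prefix.2 ab_inv_prefix.2).

Lemma boundary_actE (w : cantor_space) n :
  [/\ boundary_act a_aut w 0 = ~~ w 0,
      boundary_act b_aut w 0 = w 0,
      boundary_act a_aut w n.+1 =
        boundary_act (if w 0 then a_aut else b_aut) (fun k => w k.+1) n &
      boundary_act b_aut w n.+1 =
        boundary_act (if w 0 then a_aut else b_aut) (fun k => w k.+1) n].
Proof.
have E m : mkseq w m.+1 = w 0 :: mkseq (fun k => w k.+1) m.
  by rewrite /mkseq /= -[1]addn0 iotaDl -map_comp.
by split; rewrite /boundary_act E /=; case: (w 0).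
Qed.

Record rooted_graph (V : Type) := RootedGraph {
  rg_vertices : set V;
  rg_root : V;
  rg_adj : V -> V -> Prop }.

Definition rooted_isomorphic (V W : Type)
    (S : rooted_graph V) (T : rooted_graph W) : Prop :=
  exists f : V -> W,
    [/\ set_bij (rg_vertices S) (rg_vertices T) f,
        f (rg_root S) = rg_root T &
        forall u v, rg_vertices S u -> rg_vertices S v ->
          (rg_adj S u v <-> rg_adj T (f u) (f v))].

Section OrbitTree.
Variable G : set tree_aut.

Definition aut_orbit (v : word) : set word :=
  [set u | exists2 g : tree_aut, G g & u = g v].

Definition orbit_level (n : nat) : set (set word) :=
  [set O | exists2 v : word, size v = n & O = aut_orbit v].

Definition orbit_adj (O O' : set word) : Prop :=
  exists u v, [/\ O u, O' v & word_adj u v].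

Definition orbit_tree : rooted_graph (set word) :=
  RootedGraph [set O | exists n, orbit_level n O] (aut_orbit [::]) orbit_adj.

Definition orbit_children (O : set word) : set (set word) :=
  [set O' | exists n,
    [/\ orbit_level n O, orbit_level n.+1 O' & orbit_adj O O']].

Definition orbit_subtree (O : set word) : rooted_graph (set word) :=
  RootedGraph (clos_refl_trans _ (fun P Q => orbit_children P Q) O)
    O orbit_adj.

End OrbitTree.

Definition borel_boundary := g_sigma_algebraType (@open cantor_space).

Section NullOff.
Context d (T : measurableType d) (R : realType) (mu : probability T R).

Definition null_off (A : set T) : \bar R :=
  if `[< measurable A >] then mu A else 0%E.

Lemma null_offE A : measurable A -> null_off A = mu A.
Proof. by rewrite /null_off => mA; rewrite asboolT. Qed.

Lemma null_offN A : ~ measurable A -> null_off A = 0%E.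
Proof. by rewrite /null_off => mA; rewrite asboolF. Qed.

Let null_off0 : null_off set0 = 0%E.
Proof. by rewrite null_offE// measure0. Qed.

Let null_off_ge0 A : (0 <= null_off A)%E.
Proof. by rewrite /null_off; case: ifP. Qed.

Let null_off_sigma : semi_sigma_additive null_off.
Proof.
move=> F mF tF mUF; rewrite null_offE//.
under eq_fun do under eq_bigr do rewrite null_offE//.
exact: measure_semi_sigma_additive.
Qed.

HB.instance Definition _ := isMeasure.Build _ _ _ null_off
  null_off0 null_off_ge0 null_off_sigma.

Let null_off_setT : null_off setT = 1%E.
Proof. by rewrite null_offE// probability_setT. Qed.

HB.instance Definition _ :=
  Measure_isProbability.Build _ _ _ null_off null_off_setT.

End NullOff.

Section ErgodicSpace.
Variables (R : realType) (G : set tree_aut).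

Definition invariant_measure (mu : probability borel_boundary R) : Prop :=
  forall g (A : set borel_boundary), G g -> measurable A ->
    mu (boundary_act g @^-1` A) = mu A.

Definition ergodic_measure (mu : probability borel_boundary R) : Prop :=
  forall A : set borel_boundary, measurable A ->
    (forall g, G g -> boundary_act g @^-1` A = A) ->
    mu A = 0%E \/ mu A = 1%E.

(* Library measures are total functions on sets, with arbitrary values outside
   the sigma-algebra. Requiring those values to be 0 selects exactly one term
   per Borel measure: see [null_off] for existence and [ergodic_component_eq]
   for uniqueness. *)
Definition ergodic_component : Type :=
  {mu : probability borel_boundary R |
    [/\ invariant_measure mu, ergodic_measure mu &
        forall A : set borel_boundary, ~ measurable A -> mu A = 0%E]}.

Lemma ergodic_component_eq (mu nu : ergodic_component) :
  (forall A : set borel_boundary, measurable A ->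
     projT1 mu A = projT1 nu A) -> mu = nu.
Proof.
case: mu nu => [mu [i e z]] [nu [i' e' z']] /= H.
have E : (mu : set _ -> _) = nu.
  apply/funext => A; have [mA|mA] := pselect (measurable A); first exact: H.
  by rewrite z// z'.
suff E2 : mu = nu by subst nu; congr exist; exact: Prop_irrelevance.
clear -E. destruct mu as [m cm], nu as [m' cm']. simpl in E. subst m'. f_equal.
destruct cm as [c1 c2 c3 c4 c5 c6 c7], cm' as [d1 d2 d3 d4 d5 d6 d7].
destruct c1, c2, c3, c4, c5, c6, c7; destruct d1, d2, d3, d4, d5, d6, d7.
repeat match goal with
 | p : ?P, q : ?P |- _ =>
     first [have : p = q by exact: Prop_irrelevance | fail 1]; move=> ?; subst q
end.
by [].
Qed.

HB.instance Definition _ := gen_eqMixin ergodic_component.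
HB.instance Definition _ := gen_choiceMixin ergodic_component.

Definition bounded_continuous : Type :=
  {f : cantor_space -> R | continuous f /\ bounded_fun f}.

Definition integrals (mu : ergodic_component) :
    prod_topology (fun _ : bounded_continuous => R) :=
  fun f => (\int[projT1 mu]_x (projT1 f x : R))%R.

(* The weak topology is the coarsest one making all the maps
   mu |-> \int f dmu continuous. *)
Definition ergodic_space : Type := initial_topology integrals.

HB.instance Definition _ := Topological.on ergodic_space.

End ErgodicSpace.

Definition homeomorphic (S T : topologicalType) : Prop :=
  exists (f : S -> T) (g : T -> S),
    [/\ cancel f g, cancel g f, continuous f & continuous g].

(* Main.v *)
(** Identify an infinite word x_0 x_1 x_2 ... with the power series
    F = x_0 + x_1 t + x_2 t^2 + ... over the field of two elements.  Then b maps
    F to (1 + t) F, and a maps F to F' where 1 + t F' = (1 + t) (1 + t F), so a is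
    b restricted to the series with constant term 1.  As
    (1 + t)^(2^k) = 1 + t^(2^k), the power a^(2^k) fixes all letters before
    position 2^k - 1 and flips that one.  Hence an orbit of <a> on level m
    splits on level m + 1 unless m = 2^k - 1, and every closure of an <a>-orbit
    on the boundary contains exactly one word whose letters at the positions
    2^k - 1 all vanish.  The other letters of that word are free, so the closures
    of orbits form a Cantor set; those of <b> are coded recursively through
    b(0v) = 0b(v), b(1v) = 1a(v).

    The closure of an orbit carries exactly one invariant probability measure:
    invariance makes the cylinders of the words in an orbit of level n equally
    likely.  The same uniqueness, applied to the restriction of the measure to an
    invariant set, shows that the measure is ergodic.  Conversely an ergodic
    measure gives each clopen invariant set measure 0 or 1, so it lives on the
    closure of one orbit.  Existence: push Lebesgue measure on [0, 1) forward by
    x |-> lim g^(m_n(x)) w, where m_n(x) reads the first n binary digits of x as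
    a number with the least significant bit first. *)

Require Import Defs.
From HB Require Import structures.
From Stdlib Require Import Relation_Operators Operators_Properties.
From mathcomp Require Import all_boot all_order all_algebra.
From mathcomp Require Import all_classical all_reals all_analysis.
From mathcomp Require Import measurable_realfun.

Set Implicit Arguments.
Unset Strict Implicit.
Unset Printing Implicit Defensive.

Import Order.TTheory GRing.Theory Num.Theory.
Import numFieldNormedType.Exports.

Local Open Scope classical_set_scope.

(** * Orbits of a cyclic group on words *)

Lemma word_adj_tree_aut (g : tree_aut) v x : word_adj (g v) (g (rcons v x)).
Proof. by rewrite aut_adj; exists x; left. Qed.

Lemma tree_aut_inj (g : tree_aut) : injective g.
Proof. exact: can_inj (@aut_funK g). Qed.

(** Adjacency leaves two options for the image of a child of [v]: a child of [g v] or its parent. By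
    induction that parent is already the image of the parent of [v], so injectivity excludes it. *)
Lemma tree_aut_prefix (g : tree_aut) : extends_prefixes g.
Proof.
elim/last_ind => [|u z IHu] x.
  have [y []] := word_adj_tree_aut g [::] x; rewrite aut_root; first by exists y.
  by move/(congr1 size); rewrite size_rcons.
have [y [->|]] := word_adj_tree_aut g (rcons u z) x; first by exists y.
have [y' ->] := IHu z => /rcons_inj[/tree_aut_inj/(congr1 size)].
by rewrite !size_rcons => /eqP;
  rewrite -[X in X == _]addn0 -[X in _ == X]addn2 eqn_add2l.
Qed.

Lemma size_tree_aut (g : tree_aut) v : size (g v) = size v.
Proof.
elim/last_ind: v => [|v x IH]; first by rewrite aut_root.
by have [y ->] := tree_aut_prefix g v x; rewrite !size_rcons IH.
Qed.

Lemma take_tree_aut (g : tree_aut) n v : take n (g v) = g (take n v).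
Proof.
elim/last_ind: v => [|v x IH]; first by rewrite aut_root.
have [nv|vn] := leqP n (size v).
  have [y ->] := tree_aut_prefix g v x.
  by rewrite -!cats1 !takel_cat ?size_tree_aut ?IH.
by rewrite !take_oversize ?size_tree_aut ?size_rcons.
Qed.

Lemma expg_actS (g : tree_aut) n v : (g ^+ n.+1)%g v = g ((g ^+ n)%g v).
Proof. by rewrite expgS. Qed.

Lemma expg_actD (g : tree_aut) m n v :
  (g ^+ (m + n))%g v = (g ^+ m)%g ((g ^+ n)%g v).
Proof. by rewrite expgnDr. Qed.

(** If [h] fixes [v], it permutes the two children of [v], so [h] applied twice fixes both; each
    level doubles the exponent. *)
Lemma expg_act_pow2 (g : tree_aut) v : (g ^+ (2 ^ size v))%g v = v.
Proof.
elim/last_ind: v => [|v x IH]; first by rewrite aut_root.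
rewrite size_rcons expnS mul2n -addnn expg_actD.
set h := (g ^+ _)%g in IH *.
have [y hx] := tree_aut_prefix h v x; have [z hy] := tree_aut_prefix h v y.
rewrite hx IH hy IH; rewrite IH in hx hy.
have [xy|xy] := eqVneq x y; first by rewrite -hy -xy hx xy.
congr rcons; suff: z != y by case: (x) (y) (z) xy => -[] [].
apply: contra_neq xy => zy.
by have /tree_aut_inj/rcons_inj[] : h (rcons v x) = h (rcons v y) by rewrite hx hy zy.
Qed.

Lemma expg_act_pow2M (g : tree_aut) n q v : size v <= n ->
  (g ^+ (q * 2 ^ n))%g v = v.
Proof.
move=> vn; rewrite -(subnK vn) expnD mulnA.
elim: (q * _)%N => // p IHp.
by rewrite mulSn expg_actD IHp expg_act_pow2.
Qed.

Lemma expg_act_mod (g : tree_aut) n m v : size v <= n ->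
  (g ^+ (m %% 2 ^ n))%g v = (g ^+ m)%g v.
Proof.
by move=> vn; rewrite [in RHS](divn_eq m (2 ^ n)) addnC expg_actD expg_act_pow2M.
Qed.

(** Nonnegative powers suffice, because [g] has finite order on every level. *)
Definition orbit_equiv (g : tree_aut) (u v : word) : Prop :=
  exists m, v = (g ^+ m)%g u.

Lemma orbit_equiv_refl g u : orbit_equiv g u u. Proof. by exists 0%N. Qed.

Lemma orbit_equiv_size g u v : orbit_equiv g u v -> size v = size u.
Proof. by move=> [m ->]; rewrite size_tree_aut. Qed.

Lemma orbit_equiv_trans g u v t : orbit_equiv g u v -> orbit_equiv g v t ->
  orbit_equiv g u t.
Proof. by move=> [m ->] [n ->]; exists (n + m)%N; rewrite expg_actD. Qed.

Lemma orbit_equiv_sym g u v : orbit_equiv g u v -> orbit_equiv g v u.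
Proof.
move=> [m ->]; rewrite -(expg_act_mod _ _ (leqnn (size u))).
(* Since [r] is below [2 ^ size u], the inverse of [g ^+ r] on this level is again a nonnegative
   power. *)
set r := (m %% _)%N; exists (2 ^ size u - r)%N.
by rewrite -expg_actD subnK ?expg_act_pow2// ltnW// ltn_mod expn_gt0.
Qed.

Lemma orbit_equiv_take g n u v : orbit_equiv g u v ->
  orbit_equiv g (take n u) (take n v).
Proof. by move=> [m ->]; exists m; rewrite take_tree_aut. Qed.

Lemma orbit_equiv_rcons g u v x : orbit_equiv g u v ->
  exists y, orbit_equiv g (rcons u x) (rcons v y).
Proof.
move=> [m ->]; have [y yE] := tree_aut_prefix (g ^+ m)%g u x.
by exists y, m.
Qed.

Lemma orbit_equiv_belast g u v x y : orbit_equiv g (rcons u x) (rcons v y) ->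
  orbit_equiv g u v.
Proof.
move=> uv; have := orbit_equiv_size uv; rewrite !size_rcons => -[vu].
have := orbit_equiv_take (size u) uv.
by rewrite -!cats1 !takel_cat ?vu// -{2}vu !take_size.
Qed.

Lemma aut_orbit_cyclic g v : aut_orbit (cyclic_gen g) v = [set u | orbit_equiv g v u].
Proof.
apply/seteqP; split=> [u [h [n [->|->]] ->]|u [m ->]]; first by exists n.
- by apply: orbit_equiv_sym; exists n;
  rewrite -[RHS]/((g ^+ n * (g ^+ n)^-1)%g v) mulgV.
- by exists (g ^+ m)%g => //; exists m; left.
Qed.

Lemma eq_aut_orbit g u v :
  aut_orbit (cyclic_gen g) u = aut_orbit (cyclic_gen g) v <-> orbit_equiv g u v.
Proof.
rewrite !aut_orbit_cyclic; split=> [E|uv].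
  by have : [set t | orbit_equiv g v t] v := orbit_equiv_refl g v; rewrite -E.
apply/seteqP; split=> t /=; apply: orbit_equiv_trans => //; exact: orbit_equiv_sym.
Qed.

(** A pair of adjacent words witnesses that two orbits are adjacent; a power of [g] carries the
    shorter word to [v], so every child orbit contains an extension of [v] by one letter. *)
Lemma orbit_children_cyclic g v :
  orbit_children (cyclic_gen g) (aut_orbit (cyclic_gen g) v) =
  [set aut_orbit (cyclic_gen g) (rcons v false);
       aut_orbit (cyclic_gen g) (rcons v true)].
Proof.
apply/seteqP; split=> [P [n [[v1 v1n v1E] [v2 v2n ->]]]|P].
  move/eq_aut_orbit: v1E => /orbit_equiv_size v1v [u [u' []]].
  rewrite !aut_orbit_cyclic /= => vu v2u' [x [u'E|uE]]; last first.
    have := orbit_equiv_size vu; have := orbit_equiv_size v2u'.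
    rewrite uE size_rcons v2n -v1n v1v => -> /eqP.
    by rewrite -[X in _ == X]addn0 -[X in X == _]addn2 eqn_add2l.
  have [y uy] := orbit_equiv_rcons x (orbit_equiv_sym vu).
  rewrite -!aut_orbit_cyclic.
  have -> : aut_orbit (cyclic_gen g) v2 = aut_orbit (cyclic_gen g) (rcons v y).
    by apply/eq_aut_orbit; apply: orbit_equiv_trans v2u' _; rewrite u'E.
  by case: y {uy}; [right|left].
have child x : orbit_children (cyclic_gen g) (aut_orbit (cyclic_gen g) v)
    (aut_orbit (cyclic_gen g) (rcons v x)).
  exists (size v); split; first by exists v.
    by exists (rcons v x); rewrite ?size_rcons.
  exists v, (rcons v x); rewrite !aut_orbit_cyclic.
  by split; [exact: orbit_equiv_refl|exact: orbit_equiv_refl|exists x; left].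
by move=> [] ->; exact: child.
Qed.

(* On coefficient sequences of power series over the field of two elements, [b]
   is multiplication by 1 + t, and [a] is [b] behind a leading 1. *)
Lemma nth_ab_fun v i : (i < size v)%N ->
  nth false (a_fun v) i = nth false v i (+) nth false (true :: v) i /\
  nth false (b_fun v) i = nth false v i (+) nth false (false :: v) i.
Proof. by elim: v i => [//|[] v IH] [|i] //= /IH[]. Qed.

Lemma expg_b_true m v :
  (b_aut ^+ m)%g (true :: v) = true :: (a_aut ^+ m)%g v.
Proof. by elim: m => // m IH; rewrite !expg_actS IH. Qed.

Lemma expg_b_false m v :
  (b_aut ^+ m)%g (false :: v) = false :: (b_aut ^+ m)%g v.
Proof. by elim: m => // m IH; rewrite !expg_actS IH. Qed.

(* (1 + t)^(2^k) = 1 + t^(2^k) in characteristic two. *)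
Lemma nth_expg_b_pow2 k v i : (i < size v)%N ->
  nth false ((b_aut ^+ (2 ^ k))%g v) i =
  nth false v i (+) ((2 ^ k <= i)%N && nth false v (i - 2 ^ k)).
Proof.
elim: k v i => [|k IH] v i iv.
  rewrite expn0 expg1 (proj2 (nth_ab_fun iv)).
  by case: i iv => [|i] iv //=; rewrite subn1.
rewrite expnS mul2n -addnn expg_actD IH ?size_tree_aut// IH//.
have [ki|ik] := leqP (2 ^ k) i; last first.
  have ik' : (i < 2 ^ k + 2 ^ k)%N by rewrite (leq_trans ik) ?leq_addr.
  by rewrite /= (leqNgt (_ + _)) ik' !addbF.
rewrite andTb IH ?(leq_ltn_trans (leq_subr _ _))// leq_subRL// subnDA.
by rewrite addbA -[X in X (+) _]addbA addbb addbF.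
Qed.

Lemma nth_expg_b_low k m v i : (i < size v)%N -> (i < 2 ^ k)%N ->
  nth false ((b_aut ^+ (m * 2 ^ k))%g v) i = nth false v i.
Proof.
move=> iv ik; elim: m => // m IH;
  rewrite mulSn expg_actD nth_expg_b_pow2 ?size_tree_aut//.
by rewrite leqNgt ik addbF IH.
Qed.

(** Behind a leading 1 the letter [x] sits at position [2 ^ k], where multiplication by
    [1 + t^(2^k)] adds that leading 1; earlier positions do not change. *)
Lemma expg_a_toggle k v x : size v = (2 ^ k).-1 ->
  (a_aut ^+ (2 ^ k))%g (rcons v x) = rcons v (~~ x).
Proof.
move=> vk; have k0 : (0 < 2 ^ k)%N by rewrite expn_gt0.
have E : (b_aut ^+ (2 ^ k))%g (true :: rcons v x) = true :: rcons v (~~ x).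
  apply: (@eq_from_nth _ false) => [|i].
    by rewrite size_tree_aut /= !size_rcons.
  rewrite size_tree_aut /= size_rcons vk prednK// ltnS => ik.
  rewrite nth_expg_b_pow2 /= ?size_rcons ?vk ?prednK ?ltnS//.
  case: ltngtP ik => // [ik _|-> _].
    rewrite addbF; case: i ik => //= i ik.
    by rewrite !nth_rcons vk -ltnS prednK// ik.
  rewrite subnn /= addbT -[in LHS](prednK k0) -[in RHS](prednK k0) /=.
  by rewrite !nth_rcons vk ltnn eqxx.
by move: E; rewrite expg_b_true => -[].
Qed.

(** Write [m = q * 2 ^ k] with [q] odd. The first position of [true :: v] that [b ^+ m] can change
    is [2 ^ k], and it does change there. As [v] is fixed, this position lies beyond [true :: v];
    the hypothesis on [size v] then puts it beyond [x] as well. *)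
Lemma expg_a_stab m v x : (forall k, size v <> (2 ^ k).-1) ->
  (a_aut ^+ m)%g v = v -> (a_aut ^+ m)%g (rcons v x) = rcons v x.
Proof.
have [->//|m0] := posnP m; move=> vk mv.
have [q q2 mE] := pfactor_coprime (isT : prime 2) m0.
rewrite coprime2n in q2; move: (logn 2 m) mE => k mE.
have bv : (b_aut ^+ m)%g (true :: v) = true :: v by rewrite expg_b_true mv.
have k0 : (0 < 2 ^ k)%N by rewrite expn_gt0.
have vk1 : (size v).+1 != (2 ^ k)%N.
  by apply/eqP => /(congr1 predn); exact: vk.
have [kv|vk2] := ltnP (2 ^ k) (size v).+1.
  have := congr1 (fun t => nth false t (2 ^ k)) bv.
  (* Split off one factor [b ^+ (2 ^ k)]. The remaining exponent is a multiple of [2 ^ k.+1], hence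
     fixes positions 0 and [2 ^ k], so the split factor flips the latter. *)
  rewrite mE -(odd_double_half q) q2 mulnDl mul1n expg_actD.
  rewrite nth_expg_b_pow2 ?size_tree_aut// leqnn subnn /=.
  rewrite -mul2n mulnC mulnA -expnSr mulnC !nth_expg_b_low ?expn_gt0 //=; last first.
    by rewrite ltn_exp2l.
  by case: (nth _ _ _).
have {}vk2 : (size v).+1 < 2 ^ k by rewrite ltn_neqAle vk1.
have E : (b_aut ^+ m)%g (true :: rcons v x) = true :: rcons v x.
  apply: (@eq_from_nth _ false) => [|i]; rewrite size_tree_aut// => iv.
  rewrite mE nth_expg_b_low//; apply: leq_trans iv _.
  by rewrite /= size_rcons.
by move: E; rewrite expg_b_true => -[].
Qed.

Lemma orbit_equiv_a_toggle k v : size v = (2 ^ k).-1 ->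
  orbit_equiv a_aut (rcons v false) (rcons v true).
Proof. by move=> vk; exists (2 ^ k)%N; rewrite expg_a_toggle. Qed.

Lemma orbit_equiv_a_rcons v x y : (forall k, size v <> (2 ^ k).-1) ->
  orbit_equiv a_aut (rcons v x) (rcons v y) -> x = y.
Proof.
move=> vk [m]; have [z zE] := tree_aut_prefix (a_aut ^+ m)%g v x.
move=> /[dup]; rewrite {1}zE => /rcons_inj[mv _].
by rewrite expg_a_stab// => /rcons_inj[].
Qed.

(** * The orbit trees *)

Lemma card_set2 T (x y : T) : x <> y -> ([set x; y] #= `I_2)%card.
Proof.
move=> xy; have yx : y <> x by move/esym.
apply/card_set_bijP; exists (fun z => ~~ `[<z = x>] : nat); split.
- by move=> z _ /=; case: (~~ _).
- move=> z z'; rewrite !inE /= => -[->|->] [->|->] //;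
    by rewrite (asboolT (erefl x)) (asboolF yx).
- move=> [|[|n]] //= _; [exists x; [by left|by rewrite asboolT]|].
  by exists y; [by right|by rewrite asboolF].
Qed.

Lemma orbit_children_a1 n (O : set word) :
  orbit_level (cyclic_gen a_aut) (2 ^ n - 1) O ->
  (orbit_children (cyclic_gen a_aut) O #= `I_1)%card.
Proof.
move=> [v vn ->]; rewrite orbit_children_cyclic.
rewrite subn1 in vn; have /orbit_equiv_a_toggle/eq_aut_orbit -> := vn.
by rewrite setUid; exact: card_set1.
Qed.

Lemma orbit_children_a2 m (O : set word) : (forall n, m <> (2 ^ n - 1)%N) ->
  orbit_level (cyclic_gen a_aut) m O ->
  (orbit_children (cyclic_gen a_aut) O #= `I_2)%card.
Proof.
move=> mn [v vm ->]; rewrite orbit_children_cyclic.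
apply: card_set2 => /eq_aut_orbit /orbit_equiv_a_rcons.
by apply: contraPP => // _; apply/not_implyP; split=> // k; rewrite vm -subn1.
Qed.

(** * The recursive structure of the orbit tree of [b] *)

Lemma orbit_equiv_b_cons x v u : orbit_equiv b_aut (x :: v) u <->
  exists2 u', u = x :: u' & orbit_equiv (if x then a_aut else b_aut) v u'.
Proof.
case: x; split=> [[m ->]|[u' -> [m ->]]].
- by rewrite expg_b_true; eexists => //; exists m.
- by exists m; rewrite expg_b_true.
- by rewrite expg_b_false; eexists => //; exists m.
- by exists m; rewrite expg_b_false.
Qed.

Lemma orbit_b_cons x v : aut_orbit (cyclic_gen b_aut) (x :: v) =
  cons x @` aut_orbit (cyclic_gen (if x then a_aut else b_aut)) v.
Proof.
rewrite !aut_orbit_cyclic; apply/seteqP; split=> u /=.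
  by move/orbit_equiv_b_cons => [u' -> vu']; exists u'.
by move=> [u' vu' <-]; apply/orbit_equiv_b_cons; exists u'.
Qed.

(** The isomorphism strips the common first letter [x] from all words of an orbit; behind that
    letter [b] acts as [a] or as [b]. *)
Lemma orbit_subtree_b x :
  rooted_isomorphic
    (orbit_subtree (cyclic_gen b_aut) (aut_orbit (cyclic_gen b_aut) [:: x]))
    (orbit_tree (cyclic_gen (if x then a_aut else b_aut))).
Proof.
set g := if x then a_aut else b_aut.
have vertexP P : rg_vertices (orbit_subtree (cyclic_gen b_aut)
    (aut_orbit (cyclic_gen b_aut) [:: x])) P <->
    exists v, P = cons x @` aut_orbit (cyclic_gen g) v.
  split=> [/clos_rt_rtn1_iff|[v ->]].
    elim=> [|P1 P2 + _ [v P1v]]; first by exists [::]; rewrite orbit_b_cons.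
    rewrite P1v -orbit_b_cons orbit_children_cyclic => -[] ->.
      by exists (rcons v false); rewrite rcons_cons orbit_b_cons.
    by exists (rcons v true); rewrite rcons_cons orbit_b_cons.
  rewrite -orbit_b_cons; elim/last_ind: v => [|v y IH]; first exact: rt_refl.
  apply: rt_trans IH _; apply: rt_step; rewrite orbit_children_cyclic.
  by case: y; [right|left]; rewrite rcons_cons.
have consK (P : set word) : cons x @^-1` (cons x @` P) = P.
  apply/seteqP; split=> [u [v Pv [<-//]]|u Pu]; by exists u.
exists (fun P => cons x @^-1` P); split=> /=.
- split=> [P /vertexP[v ->]|P Q|P [n [v vn ->]]].
  + by rewrite consK; exists (size v), v.
  + rewrite !inE => /vertexP[v ->] /vertexP[u ->].
    by rewrite !consK => ->.
  + by exists (cons x @` aut_orbit (cyclic_gen g) v); rewrite ?consK//;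
    apply/vertexP; exists v.
- by rewrite orbit_b_cons consK.
- move=> P Q /vertexP[v ->] /vertexP[u ->]; rewrite !consK.
  split=> [[_ [_ [[p vp <-] [q uq <-] [y]]]]|[p [q [vp uq [y pq]]]]].
    by rewrite !rcons_cons => pq; exists p, q; split=> //; exists y; case: pq => -[];
      [left|right].
  exists (x :: p), (x :: q); split; [by exists p|by exists q|exists y].
  by rewrite !rcons_cons; case: pq => ->; [left|right].
Qed.

Lemma orbit_tree_b : exists O0 O1 : set word,
  [/\ O0 <> O1,
      orbit_children (cyclic_gen b_aut)
        (rg_root (orbit_tree (cyclic_gen b_aut))) = [set O0; O1],
      rooted_isomorphic (orbit_subtree (cyclic_gen b_aut) O0)
        (orbit_tree (cyclic_gen b_aut)) &
      rooted_isomorphic (orbit_subtree (cyclic_gen b_aut) O1)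
        (orbit_tree (cyclic_gen a_aut))].
Proof.
exists (aut_orbit (cyclic_gen b_aut) [:: false]), (aut_orbit (cyclic_gen b_aut) [::
  true]).
split; [|exact: orbit_children_cyclic|exact: orbit_subtree_b..].
by move/eq_aut_orbit/orbit_equiv_b_cons => [].
Qed.

(** * Normal forms for the orbits of [a] *)

Definition normal_word (v : word) : Prop :=
  forall k, nth false v (2 ^ k).-1 = false.

Lemma normal_rcons v x : normal_word (rcons v x) <->
  normal_word v /\ (forall k, size v = (2 ^ k).-1 -> x = false).
Proof.
split=> [vx|[nv vx] k].
  split=> k; last by move=> vk; have := vx k; rewrite nth_rcons -vk ltnn eqxx.
  have := vx k; rewrite nth_rcons; case: ifP => // vk _.
  (* Past the end [nth] returns [false], so normality constrains only positions inside the word. *)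
  by rewrite nth_default// leqNgt vk.
rewrite nth_rcons; case: ifP => // _; case: eqP => // vk.
exact: (vx k).
Qed.

(** Letter by letter: a new letter is constrained only at a position [(2 ^ k).-1], and there the
    orbit contains both extensions. *)
Lemma normal_orbit_equiv_exists v : exists u, orbit_equiv a_aut v u /\ normal_word u.
Proof.
elim/last_ind: v => [|v x [u [vu nu]]].
  by exists [::]; split=> [|k]; [exact: orbit_equiv_refl|rewrite nth_nil].
have [y vuy] := orbit_equiv_rcons x vu.
have [[k uk]|uk] := pselect (exists k, size u = (2 ^ k).-1); last first.
  by exists (rcons u y); split=> //; apply/normal_rcons; split=> // k ku; case: uk;
    exists k.
exists (rcons u false); split; last exact/normal_rcons.
case: y vuy => // vuy; apply: orbit_equiv_trans vuy _.
exact/orbit_equiv_sym/(orbit_equiv_a_toggle uk).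
Qed.

(** By induction the prefixes agree. The last letter is [false] by normality at a position
    [(2 ^ k).-1]; elsewhere the two extensions lie in different orbits. *)
Lemma normal_orbit_equiv_unique u v :
  normal_word u -> normal_word v -> orbit_equiv a_aut u v -> u = v.
Proof.
elim/last_ind: u v => [|u x IH] v.
  by move=> _ _ /orbit_equiv_size; case: v.
case/lastP: v => [|v y]; first by move=> _ _ /orbit_equiv_size; rewrite size_rcons.
move=> /normal_rcons[nu ux] /normal_rcons[nv vy] uv.
have uvE := IH _ nu nv (orbit_equiv_belast uv); subst v; congr rcons.
have [[k uk]|uk] := pselect (exists k, size u = (2 ^ k).-1).
  by rewrite (ux k uk) (vy k uk).
by apply: orbit_equiv_a_rcons uv => k uk'; apply: uk; exists k.
Qed.

Definition normal_form (v : word) : word := projT1 (cid (normal_orbit_equiv_exists v)).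

Lemma normal_formP v : orbit_equiv a_aut v (normal_form v) /\ normal_word
  (normal_form v).
Proof. by rewrite /normal_form; case: cid. Qed.

Lemma orbit_equiv_normal_form u v : orbit_equiv a_aut u v ->
  normal_form u = normal_form v.
Proof.
have [uu nu] := normal_formP u; have [vv nv] := normal_formP v.
move=> uv; apply: normal_orbit_equiv_unique => //.
exact: orbit_equiv_trans (orbit_equiv_sym uu) (orbit_equiv_trans uv vv).
Qed.

Lemma normal_form_id v : normal_word v -> normal_form v = v.
Proof.
by move=> nv; have [vv nv'] := normal_formP v;
  rewrite -(normal_orbit_equiv_unique nv nv' vv).
Qed.

Lemma size_normal_form v : size (normal_form v) = size v.
Proof. by have [/orbit_equiv_size] := normal_formP v. Qed.

(** Prefixes of normal words are normal, so by uniqueness normal forms are compatible with prefixes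
    and extend to infinite words. *)
Lemma normal_form_rcons v x :
  exists y, normal_form (rcons v x) = rcons (normal_form v) y.
Proof.
have [cvx] := normal_formP (rcons v x); have := size_normal_form (rcons v x).
case/lastP: (normal_form (rcons v x)) cvx => [|u y] cvx; first by rewrite size_rcons.
move=> _ /normal_rcons[nu _]; exists y; congr rcons.
have [vv nv] := normal_formP v; apply: normal_orbit_equiv_unique => //.
exact: orbit_equiv_trans (orbit_equiv_sym (orbit_equiv_belast cvx)) vv.
Qed.

(** * Cylinders in the Cantor space *)

Lemma eq_mkseqP (w w' : nat -> bool) n :
  mkseq w n = mkseq w' n <-> forall i, (i < n)%N -> w i = w' i.
Proof.
split=> [ww' i ilt|ww'].
  by have := congr1 (nth false ^~ i) ww'; rewrite !nth_mkseq.
apply: (@eq_from_nth _ false) => [|i]; rewrite !size_mkseq// => ilt.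
by rewrite !nth_mkseq// ww'.
Qed.

Lemma take_mkseq (w : nat -> bool) m n : (m <= n)%N -> take m (mkseq w n) = mkseq w m.
Proof.
move=> mn; apply: (@eq_from_nth _ false) => [|i].
  by rewrite size_take_min !size_mkseq; exact/minn_idPl.
rewrite size_take_min size_mkseq (minn_idPl mn) => im.
by rewrite nth_take// !nth_mkseq// (leq_trans im).
Qed.

Lemma eq_mkseq_le (w w' : nat -> bool) m n : (m <= n)%N ->
  mkseq w n = mkseq w' n -> mkseq w m = mkseq w' m.
Proof. by move=> mn ww'; rewrite -(take_mkseq _ mn) ww' take_mkseq. Qed.

Lemma mkseq_cons (w : nat -> bool) n :
  mkseq w n.+1 = w 0 :: mkseq (fun i => w i.+1) n.
Proof. by rewrite /mkseq /= -[1]addn0 iotaDl -map_comp. Qed.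

Definition cyl n (v : word) : set cantor_space := [set w | mkseq w n = v].

(** The product topology is the supremum of the coordinate topologies: long cylinders refine each
    coordinate neighbourhood, and a cylinder is a finite intersection of such neighbourhoods. *)
Lemma nbhs_cantorP (w : cantor_space) (U : set cantor_space) :
  nbhs w U <-> exists n, cyl n (mkseq w n) `<=` U.
Proof.
pose F := filter_from [set: nat] (fun n => cyl n (mkseq w n)).
have FF : Filter F.
  apply: filter_from_filter; first by exists 0.
  move=> m n _ _; exists (maxn m n) => // w' /= ww'.
  by split; apply: eq_mkseq_le ww'; rewrite ?leq_maxl ?leq_maxr.
split=> [|[n nU]].
  have : F --> w.
    apply/cvg_sup => i A /= [B [[C _ <-] Ci CA]].
    exists i.+1 => // w' /eq_mkseqP ww'; apply: CA => /=.
    by move: Ci; rewrite /= /proj ww'.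
  by move=> /[apply] -[n _ nU]; exists n.
apply: filterS nU _.
elim: n => [|n IH]; first by apply: filterS filterT => w' _ /=.
have wn : nbhs w [set w' | w' n = w n].
  exact: (@proj_continuous _ (fun=> bool) n w [set w n] (discrete_set1 _)).
apply: filterS (filterI IH wn) => w' [] /= ww' ww'n.
by rewrite /cyl /= !mkseqS ww' ww'n.
Qed.

Lemma open_cyl n v : open (cyl n v).
Proof.
by rewrite openE => w <-; apply/nbhs_cantorP; exists n.
Qed.

Lemma continuous_cantor (S : topologicalType) (f : S -> cantor_space) :
  (forall x i, \forall y \near x, f y i = f x i) -> continuous f.
Proof.
move=> fi x U /nbhs_cantorP[n nU]; rewrite nbhs_filterE.
apply: filterS (_ : nbhs x [set y | mkseq (f y) n = mkseq (f x) n]) => [y /nU//|].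
elim: n {nU} => [|n IH]; first by apply: filterS filterT => w' _ /=.
by apply: filterS (filterI IH (fi x n)) => y [] /= E En; rewrite !mkseqS E En.
Qed.

Definition local_fun T (f : cantor_space -> nat -> T) : Prop :=
  forall n, exists m, forall w w' : cantor_space,
    mkseq w m = mkseq w' m -> f w n = f w' n.

Lemma local_fun_near T (f : cantor_space -> nat -> T) : local_fun f ->
  forall (w : cantor_space) n, \forall w' \near w, f w' n = f w n.
Proof.
move=> fl w n; have [m mn] := fl n.
by apply/nbhs_cantorP; exists m => w' /= /mn.
Qed.

Lemma local_fun_continuous (f : cantor_space -> cantor_space) :
  local_fun f -> continuous f.
Proof. by move=> fl; apply: continuous_cantor; exact: local_fun_near. Qed.

Lemma mkseq_boundary_act g w n : mkseq (boundary_act g w) n = g (mkseq w n).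
Proof.
apply: (@eq_from_nth _ false) => [|i].
  by rewrite size_tree_aut !size_mkseq.
rewrite size_mkseq => ilt; rewrite nth_mkseq// /boundary_act.
by rewrite -(take_mkseq w ilt) -take_tree_aut nth_take.
Qed.

(** This says that [w'] lies in the closure of the orbit of [w]. *)
Definition boundary_equiv g (w w' : nat -> bool) : Prop :=
  forall n, orbit_equiv g (mkseq w n) (mkseq w' n).

Lemma boundary_equiv_sym g w1 w2 : boundary_equiv g w1 w2 -> boundary_equiv g w2 w1.
Proof. by move=> h1 n; exact: orbit_equiv_sym. Qed.

Lemma orbit_equiv_cyclic g h v : cyclic_gen g h -> orbit_equiv g v (h v).
Proof.
move=> gh; have : aut_orbit (cyclic_gen g) v (h v) by exists h.
by rewrite aut_orbit_cyclic.
Qed.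

Lemma boundary_equiv_act g h w : cyclic_gen g h ->
  boundary_equiv g w (boundary_act h w).
Proof. by move=> gh n; rewrite mkseq_boundary_act; exact: orbit_equiv_cyclic. Qed.

(** * Cylinders as a generating system closed under intersection *)

Definition cylinders : set (set borel_boundary) := [set A | exists n v, A = cyl n v].

Lemma measurable_open (U : set cantor_space) : open U ->
  measurable (U : set borel_boundary).
Proof. exact: sub_sigma_algebra. Qed.

Lemma measurable_cyl n v : measurable (cyl n v : set borel_boundary).
Proof. by apply: measurable_open; exact: open_cyl. Qed.
#[local] Hint Resolve measurable_cyl : core.

Lemma cylinders_generate :
  @measurable _ borel_boundary = <<s cylinders >>.
Proof.
apply/seteqP; split; apply: smallest_sub.
- exact: smallest_sigma_algebra.
- move=> U oU; pose GT := g_sigma_algebraType cylinders.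
  (* Indexing by all words keeps the union countable; cylinders not inside [U] are replaced by the
     empty set. *)
  have -> : U = \bigcup_(v in [set: word])
      (if `[< cyl (size v) v `<=` U >] then cyl (size v) v else set0).
    apply/seteqP; split=> [w Uw|w [v _]]; last by case: asboolP => [vU /vU|_ []].
    have /nbhs_cantorP[n nU] : nbhs (w : cantor_space) U by exact: open_nbhs_nbhs.
    by exists (mkseq w n) => //; rewrite size_mkseq asboolT.
  apply: (@countable_bigcupT_measurable _ GT) => [|v]; first exact: countableP.
  case: asboolP => _; last exact: (@measurable0 _ GT).
  by apply: sub_sigma_algebra; exists (size v), v.
- exact: sigma_algebra_measurable.
- by move=> _ [n [v ->]].
Qed.

Lemma setI_closed_cylinders : setI_closed cylinders.
Proof.
suff H m n u v : (m <= n)%N -> cylinders (cyl m u `&` cyl n v).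
  move=> _ _ [m [u ->]] [n [v ->]].
  by have [mn|/ltnW nm] := leqP m n; [exact: H|rewrite setIC; exact: H].
move=> mn; have [uv|uv] := eqVneq (take m v) u.
  exists n, v; apply/seteqP; split=> [w []//|w /= wv]; split=> //=.
  by rewrite -uv -wv take_mkseq.
(* Incompatible prefixes: the empty intersection is the cylinder of a word of the wrong length. *)
exists 0, [:: true]; apply/seteqP; split=> // w [/= wu wv].
by move: uv; rewrite -wv take_mkseq// wu eqxx.
Qed.

Section InvariantMeasures.
Local Open Scope ring_scope.
Local Open Scope ereal_scope.
Variable R : realType.

Lemma eq_measure_cyl (m1 m2 : {measure set borel_boundary -> \bar R}) :
  (forall n v, m1 (cyl n v) = m2 (cyl n v)) -> m1 setT < +oo ->
  forall A, measurable A -> m1 A = m2 A.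
Proof.
move=> m12 fin A mA.
apply: (measure_unique cylinders (fun=> setT)) => //.
- exact: cylinders_generate.
- exact: setI_closed_cylinders.
- move=> _; exists 0%N, [::]; apply/seteqP; split=> // w.
- by apply/seteqP; split=> // w _; exists 0%N.
- by move=> _ [n [v ->]].
Qed.

Lemma measure_cyl_sum (m : {measure set borel_boundary -> \bar R}) n :
  \sum_(v : n.-tuple bool) m (cyl n v) = m setT.
Proof.
rewrite fsbig_seq ?index_enum_uniq//.
rewrite -measure_fin_bigcup.
- congr (m _); rewrite -subTset => w _.
  have wn : size (mkseq w n) == n by rewrite size_mkseq.
  by exists (Tuple wn) => //=; rewrite mem_index_enum.
- exact: finite_finset.
- by move=> u v _ _ [w [/= wu wv]]; apply: val_inj; rewrite /= -wu -wv.
- by move=> v _.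
Qed.

End InvariantMeasures.

(** * Binary digits of a uniform random number *)

Section BinaryDigits.
Variable R : realType.
Local Open Scope ring_scope.
Implicit Types (x : R) (n : nat).

(** For [x >= 0] this is the binary digit of weight [2^-(n+1)]. *)
Definition bin_digit x n : bool := odd (Num.truncn (2 ^+ n.+1 * x)).

(* The first binary digit of x is the least significant bit, so that these
   numbers converge to a dyadic integer as n grows. *)
Fixpoint digit_sum x n : nat :=
  if n is m.+1 then (digit_sum x m + bin_digit x m * 2 ^ m)%N else 0%N.

Lemma ltn_digit_sum x n : (digit_sum x n < 2 ^ n)%N.
Proof.
elim: n => //= n IH; rewrite expnS mul2n -addnn.
by case: bin_digit; rewrite ?mul1n ?mul0n ?ltn_add2r// addn0 (leq_trans IH)// leq_addr.
Qed.

Lemma digit_sum_mod x m n : (m <= n)%N -> (digit_sum x n %% 2 ^ m)%N = digit_sum x m.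
Proof.
move=> mn; rewrite -(subnK mn); elim: (n - m)%N => [|k IH].
  by rewrite add0n modn_small// ltn_digit_sum.
by rewrite addSn /= expnD mulnA addnC modnMDl.
Qed.

(** Both numbers read the first [n] digits of [x], in opposite orders, so [k] is the bit reversal of
    [y]. *)
Lemma digit_sum_truncn n y : (y < 2 ^ n)%N -> exists2 k, (k < 2 ^ n)%N &
  forall x, 0 <= x < 1 -> (digit_sum x n == y) = (Num.truncn (2 ^+ n * x) == k).
Proof.
elim: n y => [|n IH] y yn.
  exists 0%N => // x /andP[x0 x1]; move: yn; rewrite expn0 ltnS leqn0 => /eqP -> /=.
  by rewrite eqxx expr0 mul1r truncn_eq// x0 x1.
have y'n : (y %% 2 ^ n < 2 ^ n)%N by rewrite ltn_mod expn_gt0.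
have [k kn kE] := IH _ y'n; pose b := (2 ^ n <= y)%N.
have yE : y = (y %% 2 ^ n + b * 2 ^ n)%N.
  rewrite /b; case: leqP => [ny|yn']; last by rewrite modn_small// addn0.
  rewrite mul1n -{2}(subnK ny) modnDr modn_small ?subnK//.
  by rewrite ltn_subLR// addnn -mul2n -expnS.
(* The top bit [b] of [y] becomes the lowest bit of the new [k]. *)
exists (k.*2 + b)%N => [|x x01].
  have : (k.*2.+1 < (2 ^ n).*2)%N by rewrite -doubleS leq_double.
  rewrite expnS mul2n; apply: leq_ltn_trans; by rewrite -addn1 leq_add2l leq_b1.
have /andP[x0 x1] := x01; have X0 : 0 <= 2 ^+ n * x by rewrite mulr_ge0// exprn_ge0.
have tE : Num.truncn (2 ^+ n * x) = (Num.truncn (2 ^+ n.+1 * x))./2.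
  apply: truncn_def; have := truncn_itv (_ : 0 <= 2 ^+ n.+1 * x).
  rewrite mulr_ge0 ?exprn_ge0// => /(_ isT); set t := Num.truncn _ => /andP[t1 t2].
  rewrite -(@ler_pM2l _ 2)// -(@ltr_pM2l _ 2)// !mulrA -!exprS -!natrM !mul2n.
  rewrite (le_trans _ t1) ?(lt_le_trans t2) ?ler_nat//.
    by rewrite doubleS !ltnS -{1}(odd_double_half t); case: odd.
  by rewrite -{2}(odd_double_half t) leq_addl.
rewrite /=; set t := Num.truncn _.
transitivity ((digit_sum x n == (y %% 2 ^ n)%N) && (bin_digit x n == b)).
  apply/eqP/andP => [E|[/eqP -> /eqP ->]]; last by rewrite -yE.
  have E2 := congr1 (modn^~ (2 ^ n)%N) E;
    rewrite addnC modnMDl modn_small ?ltn_digit_sum// in E2.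
  rewrite E2 eqxx; split=> //; move: E; rewrite {1}yE -E2 => /eqP.
  by rewrite eqn_add2l eqn_pmul2r ?expn_gt0//; case: bin_digit; case: (b).
rewrite kE// tE -/t /bin_digit -/t -{3}(odd_double_half t) addnC.
apply/andP/eqP => [[/eqP -> /eqP ->]//|E].
have E1 := congr1 half E; have E2 := congr1 odd E; move: E1 E2.
rewrite ![(_.*2 + _)%N]addnC !half_bit_double !oddD !odd_double !oddb !addbF.
by move=> -> ->.
Qed.

(** The sets [k < truncn (c * x)] are preimages of closed half-lines, each fibre of the truncation
    is a difference of two of them, and [Q] selects countably many fibres. *)
Lemma measurable_truncn_preimage (c : R) (Q : nat -> Prop) :
  measurable [set x : R | Q (Num.truncn (c * x))].
Proof.
have mlt k : measurable [set x : R | (k < Num.truncn (c * x))%N].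
  have -> : [set x : R | (k < Num.truncn (c * x))%N] = ( *%R c) @^-1` `[k.+1%:R, +oo[.
    by apply/seteqP; split=> x /=; rewrite in_itv/= andbT truncn_gt_nat.
  rewrite -[X in measurable X]setTI.
  by apply: (continuous_measurable_fun (@mulrl_continuous _ c)) => //;
    exact: measurable_itv.
have -> : [set x : R | Q (Num.truncn (c * x))] = \bigcup_(k in Q)
    ([set x : R | (k < (Num.truncn (c * x)).+1)%N] `&` ~` [set x :
      R | (k < Num.truncn (c * x))%N]).
  apply/seteqP; split=> [x Qx|x [k Qk [/= k1 /negP k2]]].
    by exists (Num.truncn (c * x)) => //; split=> /=; rewrite ?ltnn.
  suff -> : Num.truncn (c * x) = k by [].
  by apply/eqP; rewrite eqn_leq leqNgt k2.
apply: bigcup_measurable => k _; apply: measurableI; last exact: measurableC.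
case: k => [|k]; last exact: mlt.
by rewrite [X in measurable X](_ : _ = setT)//; apply/seteqP; split.
Qed.

Lemma measurable_digit_sum n (Q : nat -> Prop) :
  measurable [set x | Q (digit_sum x n)].
Proof.
elim: n Q => [|n IH] Q.
  have [q|q] := pselect (Q 0%N).
    by rewrite [X in measurable X](_ : _ = setT)//; apply/seteqP; split.
  by rewrite [X in measurable X](_ : _ = set0)//; apply/seteqP; split.
pose D := [set x | bin_digit x n]; have mD : measurable D.
  exact: (measurable_truncn_preimage _ odd).
rewrite [X in measurable X](_ : _ =
  ([set x | Q (digit_sum x n + 2 ^ n)%N] `&`
    D) `|` ([set x | Q (digit_sum x n)] `\` D)).
  apply: measurableU; first by apply: measurableI => //;
    exact: (IH (fun y => Q (y + 2 ^ n)%N)).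
  by apply: measurableD => //; exact: IH.
apply/seteqP; split=> x; rewrite /D /=; case: bin_digit; rewrite ?mul1n ?mul0n ?addn0.
- by left.
- by right.
- by case=> [[]//|[_ []]].
- by case=> [[]//|[]].
Qed.

(** * Uniform distribution of the digit numbers *)

Definition unit_lebesgue : set (measurableTypeR R) -> \bar R :=
  mrestr (@lebesgue_measure R) (measurable_itv `[0, 1[).

HB.instance Definition _ := Measure.copy unit_lebesgue
  (mrestr (@lebesgue_measure R) (measurable_itv `[0, 1[)).

Let unit_lebesgueT : unit_lebesgue setT = 1%E.
Proof.
by rewrite /unit_lebesgue /mrestr setTI lebesgue_measure_itv/= lte_fin ltr01 oppr0
  adde0.
Qed.

HB.instance Definition _ :=
  Measure_isProbability.Build _ _ _ unit_lebesgue unit_lebesgueT.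

Lemma unit_lebesgue_digit_sum1 n y : (y < 2 ^ n)%N ->
  unit_lebesgue [set x | digit_sum x n = y] = ((2 ^+ n)^-1)%:E.
Proof.
move=> yn; have [k kn kE] := digit_sum_truncn yn.
have n0 : 0 < 2 ^+ n :> R by rewrite exprn_gt0.
rewrite /unit_lebesgue /mrestr.
(* Within the unit interval the fibre is a single dyadic interval of length [2^-n]. *)
have -> : [set x | digit_sum x n = y] `&` `[0, 1[ =
    [set` `[k%:R / 2 ^+ n, k.+1%:R / 2 ^+ n[] :> set R.
  apply/seteqP; split=> x /=; rewrite !in_itv/=.
    move=> [/eqP + x01]; rewrite kE// => /eqP tE.
    have /andP[x0 _] := x01.
    have := truncn_itv (_ : 0 <= 2 ^+ n * x);
      rewrite tE mulr_ge0 ?exprn_ge0// => /(_ isT).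
    by rewrite ler_pdivrMr// ltr_pdivlMr// ![x * _]mulrC.
  rewrite ler_pdivrMr// ltr_pdivlMr// ![x * _]mulrC => /andP[h1 h2].
  have x01 : 0 <= x < 1.
    rewrite -(pmulr_rge0 _ n0) (le_trans _ h1)//=.
    rewrite -(ltr_pM2l n0) mulr1 (lt_le_trans h2)// -natrX ler_nat//.
  split=> //; apply/eqP; rewrite kE//; apply/eqP/truncn_def.
  by rewrite h1 h2.
rewrite lebesgue_measure_itv/= lte_fin ltr_pM2r ?invr_gt0// ltr_nat ltnSn.
by rewrite -EFinB -mulrBl -natrB// subSnn mul1r.
Qed.

Lemma unit_lebesgue_digit_sum n (Q : pred nat) :
  unit_lebesgue [set x | Q (digit_sum x n)] =
  (#|[pred y : 'I_(2 ^ n) | Q y]|%:R / 2 ^+ n)%:E.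
Proof.
have -> : [set x | Q (digit_sum x n)] =
    \bigcup_(y in [set` [seq y :
      'I_(2 ^ n) <- index_enum _ | Q y]]) [set x | digit_sum x n = nat_of_ord y].
  apply/seteqP; split=> [x Qx|x [y]].
    by exists (Ordinal (ltn_digit_sum x n)) => //=;
      rewrite mem_filter Qx mem_index_enum.
  by rewrite /= mem_filter => /andP[Qy _] ->.
rewrite measure_fin_bigcup//=; last first.
- by move=> y _; exact: (measurable_digit_sum n (fun z => z = y)).
- by move=> y z _ _ [x [/= yx zx]]; apply: val_inj; rewrite /= -yx -zx.
rewrite -fsbig_seq ?filter_uniq ?index_enum_uniq// big_filter.
under eq_bigr do rewrite unit_lebesgue_digit_sum1//.
by rewrite sumEFin sumr_const mulr_natl.
Qed.

End BinaryDigits.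

(** * Invariant measures on closures of orbits *)

Lemma preimage_cyl_act g n v : boundary_act g @^-1` cyl n (g v) = cyl n v.
Proof.
apply/seteqP; split=> w; rewrite /cyl /= mkseq_boundary_act; first exact: tree_aut_inj.
by move=> ->.
Qed.

Lemma measurable_boundary_act g :
  measurable_fun setT (boundary_act g : borel_boundary -> borel_boundary).
Proof.
apply: (measurability cylinders); first exact: cylinders_generate.
move=> _ [_ [n [v ->]] <-]; rewrite setTI -(aut_invK g v) preimage_cyl_act.
exact: measurable_cyl.
Qed.

(** A copy of [boundary_act] typed between Borel spaces, to carry the measurable function structure
    that [distribution] expects. *)
Definition borel_act g : borel_boundary -> borel_boundary := boundary_act g.

HB.instance Definition _ g := isMeasurableFun.Build _ _ borel_boundary borel_boundary
  (borel_act g) (measurable_boundary_act g).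

Section OrbitMeasures.
Variable R : realType.
Local Open Scope ring_scope.
Local Open Scope ereal_scope.
Implicit Types (m : {measure set borel_boundary -> \bar R}) (g : tree_aut).
Implicit Types (w : cantor_space) (f : set borel_boundary -> \bar R).

Definition cyl_invariant g f := forall n v, f (cyl n (g v)) = f (cyl n v).

(** For a measure this means that the complement of the closure of the orbit of [w], a countable
    union of such cylinders, is null. *)
Definition supported_on_orbit g w f :=
  forall n v, ~ orbit_equiv g (mkseq w n) v -> f (cyl n v) = 0.

Lemma cyl_invariant_orbit_equiv g f n u v :
  cyl_invariant g f -> orbit_equiv g u v -> f (cyl n v) = f (cyl n u).
Proof. by move=> mg [k ->]; elim: k => // k <-; rewrite expg_actS mg. Qed.

Lemma cyl_le m n v : m (cyl n v) <= m setT.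
Proof. by apply: le_measure; rewrite ?inE//; exact: measurable_cyl. Qed.

(** On each level the cylinders of the orbit share the total mass equally, so the masses of all
    cylinders are determined. Arbitrary finite total mass is allowed so that restrictions of a
    measure are covered. *)
Lemma orbit_measure_unique g w m1 m2 :
  cyl_invariant g m1 -> cyl_invariant g m2 ->
  supported_on_orbit g w m1 -> supported_on_orbit g w m2 ->
  m1 setT = m2 setT -> m1 setT < +oo ->
  forall A, measurable A -> m1 A = m2 A.
Proof.
move=> i1 i2 s1 s2 m12 m1fin; apply: eq_measure_cyl => // n v.
have [wv|wv] := pselect (orbit_equiv g (mkseq w n) v); last by rewrite s1// s2.
rewrite (cyl_invariant_orbit_equiv _ i1 wv) (cyl_invariant_orbit_equiv _ i2 wv).
have total m : cyl_invariant g m -> supported_on_orbit g w m -> m setT < +oo ->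
    m setT = (fine (m (cyl n (mkseq w n))) *+
      #|[pred u : n.-tuple bool | `[<orbit_equiv g (mkseq w n) u>]]|)%:E.
  move=> im sm mfin; rewrite -(measure_cyl_sum m n).
  rewrite (bigID (fun u : n.-tuple bool => `[<orbit_equiv g (mkseq w n) u>]))/=.
  rewrite [X in _ + X]big1 ?adde0; last by move=> u /asboolP; exact: sm.
  rewrite -sumr_const -sumEFin; apply: eq_bigr => u /asboolP wu.
  rewrite (cyl_invariant_orbit_equiv _ im wu) fineK// ge0_fin_numE//.
  exact: le_lt_trans (cyl_le _ _ _) mfin.
have m2fin : m2 setT < +oo by rewrite -m12.
have fin m : m setT < +oo -> m (cyl n (mkseq w n)) \is a fin_num.
  by move=> mfin; rewrite ge0_fin_numE//; exact: le_lt_trans (cyl_le _ _ _) mfin.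
have := m12; rewrite total// [in RHS]total// => -[].
have N0 : (0 < #|[pred u : n.-tuple bool | `[<orbit_equiv g (mkseq w n) u>]]|)%N.
  have wn : size (mkseq w n) == n by rewrite size_mkseq.
  by apply/card_gt0P; exists (Tuple wn); rewrite inE /=; exact: orbit_equiv_refl.
move=> /eqP; rewrite eqr_pMn2r// => /eqP E.
by rewrite -(fineK (fin _ m1fin)) E fineK// fin.
Qed.

(** The image of [mu] under [h] agrees with [mu] on cylinders, since [h] maps each word to an
    equivalent one; cylinders determine a finite measure. *)
Lemma cyl_invariant_measure g (mu : probability borel_boundary R) :
  cyl_invariant g mu -> invariant_measure (cyclic_gen g) mu.
Proof.
move=> mug h A gh mA.
rewrite -[LHS]/(distribution mu (borel_act h) A).
apply: (@eq_measure_cyl R (distribution mu (borel_act h)) mu) => //; last first.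
  by rewrite [X in X < _](@probability_setT _ _ _ (distribution mu (borel_act h))) ltry.
move=> n v; rewrite -(aut_invK h v) /= /distribution /pushforward /= preimage_cyl_act.
by rewrite (cyl_invariant_orbit_equiv _ mug (orbit_equiv_cyclic _ gh)).
Qed.

Lemma invariant_cyl g (mu : probability borel_boundary R) :
  invariant_measure (cyclic_gen g) mu -> cyl_invariant g mu.
Proof.
move=> mug n v; rewrite -(mug g) ?preimage_cyl_act//; by exists 1%N; left.
Qed.

(** The restriction of [mu] to [A] and the multiple of [mu] by [mu A] are both invariant, live on
    the same orbit closure and have equal mass, so they coincide. Evaluated at [A] this gives
    [mu A = mu A * mu A]. *)
Lemma supported_ergodic g w (mu : probability borel_boundary R) :
  cyl_invariant g mu -> supported_on_orbit g w mu ->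
  ergodic_measure (cyclic_gen g) mu.
Proof.
move=> mug muw A mA gA; have gg : cyclic_gen g g by exists 1%N; left.
have fA : mu A \is a fin_num by exact: fin_num_measure.
have muA0 : (0 <= fine (mu A))%R by exact: fine_ge0.
have E : mrestr mu mA A = mscale (NngNum muA0) mu A.
  apply: (@orbit_measure_unique g w) => //.
  - move=> n v; rewrite /= /mrestr -(cyl_invariant_measure mug gg); last first.
      by apply: measurableI => //; exact: measurable_cyl.
    by rewrite preimage_setI preimage_cyl_act gA.
  - by move=> n v; rewrite /= /mscale; congr (_ * _); exact: mug.
  - move=> n v wv; apply/eqP; rewrite -measure_le0/= /mrestr -(muw _ _ wv).
    by rewrite le_measure// inE; [apply: measurableI => //|]; exact: measurable_cyl.
  - move=> n v wv; rewrite /= /mscale [X in _ * X](_ : _ = 0) ?mule0//; exact: muw.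
  - rewrite /= /mscale /mrestr setTI.
    transitivity ((fine (mu A))%:E * 1); first by rewrite mule1 fineK.
    by congr (_ * _); apply/esym; exact: probability_setT.
  - by rewrite /= /mrestr setTI ltey_eq fA.
move: E; rewrite /mscale /mrestr /= setIid fineK// => E.
move: E; rewrite -(fineK fA) -EFinM => -[] /eqP.
rewrite -{1}[fine _]mul1r -subr_eq0 -mulrBl mulf_eq0 subr_eq0 => /orP[/eqP <-|/eqP ->].
  by right.
by left.
Qed.

(* The limit of g^(digit_sum x n) w: a prefix of length n only depends on the
   exponent modulo 2^n. *)
Definition orbit_point g w (x : measurableTypeR R) : borel_boundary :=
  fun n => nth false ((g ^+ digit_sum x n.+1)%g (mkseq w n.+1)) n.

Lemma mkseq_orbit_point g w x n :
  mkseq (orbit_point g w x) n = (g ^+ digit_sum x n)%g (mkseq w n).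
Proof.
apply: (@eq_from_nth _ false) => [|i]; rewrite ?size_tree_aut !size_mkseq// => ilt.
rewrite nth_mkseq// /orbit_point -(digit_sum_mod _ ilt) expg_act_mod ?size_mkseq//.
by rewrite -(take_mkseq w ilt) -take_tree_aut nth_take.
Qed.

Lemma preimage_orbit_point g w n v : orbit_point g w @^-1` cyl n v =
  [set x | (g ^+ digit_sum x n)%g (mkseq w n) = v].
Proof. by apply/seteqP; split=> x; rewrite /cyl /= mkseq_orbit_point. Qed.

Lemma measurable_orbit_point g w : measurable_fun setT (orbit_point g w).
Proof.
apply: (measurability cylinders); first exact: cylinders_generate.
move=> _ [_ [n [v ->]] <-]; rewrite setTI preimage_orbit_point.
exact (measurable_digit_sum n (fun k => (g ^+ k)%g (mkseq w n) = v)).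
Qed.

HB.instance Definition _ g w := isMeasurableFun.Build _ _ (measurableTypeR R)
  borel_boundary
  (orbit_point g w) (measurable_orbit_point g w).

Definition orbit_measure g w : probability borel_boundary R :=
  distribution (@unit_lebesgue R) (orbit_point g w).

Lemma orbit_measure_cyl g w n v : orbit_measure g w (cyl n v) =
  (#|[pred y : 'I_(2 ^ n) | (g ^+ y)%g (mkseq w n) == v]|%:R / 2 ^+ n)%:E.
Proof.
rewrite /= /distribution /pushforward preimage_orbit_point.
rewrite -(unit_lebesgue_digit_sum R n (fun y => (g ^+ y)%g (mkseq w n) == v)).
by congr unit_lebesgue; apply/seteqP; split=> x /eqP.
Qed.

(** The shift of [y] to [y + 1] modulo [2 ^ n] matches the exponents that reach [v] with those that
    reach [g v]. *)
Lemma orbit_measure_invariant g w : cyl_invariant g (orbit_measure g w).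
Proof.
move=> n v; rewrite !orbit_measure_cyl; congr (_%:R / _)%:E.
rewrite -!sum1_card [LHS](reindex_inj (@ordS_inj _)); apply: eq_bigl => y.
by rewrite !inE /= expg_act_mod ?size_mkseq// expg_actS (inj_eq (@tree_aut_inj g)).
Qed.

Lemma orbit_measure_supported g w : supported_on_orbit g w (orbit_measure g w).
Proof.
move=> n v wv; rewrite orbit_measure_cyl.
rewrite (_ : #|_| = 0%N) ?mul0r//; apply: eq_card0 => y; rewrite !inE.
by apply/eqP => yv; apply: wv; exists y.
Qed.

Lemma null_off_ergodic G (mu : probability borel_boundary R) :
  invariant_measure G mu -> ergodic_measure G mu ->
  [/\ invariant_measure G (null_off mu), ergodic_measure G (null_off mu) &
      forall A : set borel_boundary, ~ measurable A -> null_off mu A = 0].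
Proof.
move=> inv erg; split=> [h A Gh mA|A mA GA|A mA].
- rewrite /= !null_offE ?inv//.
  rewrite -[X in measurable X]setTI; exact: measurable_boundary_act.
- by rewrite /= null_offE//; exact: erg.
- by rewrite null_offN.
Qed.

Definition orbit_component g w : ergodic_component R (cyclic_gen g) :=
  exist _ (null_off (orbit_measure g w) : probability borel_boundary R)
    (null_off_ergodic (cyl_invariant_measure (@orbit_measure_invariant g w))
      (supported_ergodic (@orbit_measure_invariant g w) (@orbit_measure_supported g
        w))).

End OrbitMeasures.

(** * The space of ergodic measures *)

Section WeakTopology.
Variable R : realType.
Local Open Scope ring_scope.

Lemma continuous_integral G (f : bounded_continuous R) :
  continuous (fun mu : ergodic_space R G => integrals mu f).
Proof.
move=> mu A Af.
have /cvg_sup/(_ f) tf : nbhs (integrals mu) --> integrals mu by exact: cvg_id.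
apply: (@initial_continuous _ _ (@integrals R G) mu (proj f @^-1` A)).
exact/tf/initial_continuous.
Qed.

(** The weak topology is initial for a map into a product, so continuity can be tested on one
    integrand at a time. *)
Lemma continuous_ergodic (S : topologicalType) G (h : S -> ergodic_space R G) :
  (forall f : bounded_continuous R, continuous (fun x => integrals (h x) f)) ->
  continuous h.
Proof.
move=> hf; apply: continuous_comp_initial => x; apply/cvg_sup => f.
move=> A /= [B [[C oC <-] Cx CA]]; apply: filterS CA _; apply: (hf f x).
exact: open_nbhs_nbhs.
Qed.

(** Each point has a cylinder on which [f] stays within [e / 2] of its value there; compactness
    gives one prefix length for all points. *)
Lemma cantor_uniform_continuity (f : cantor_space -> R) (e : R) :
  continuous f -> 0 < e -> exists n, forall w w' : cantor_space,
    mkseq w n = mkseq w' n -> `|f w - f w'| < e.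
Proof.
move=> cf e0; have e2 : 0 < e / 2 by rewrite divr_gt0.
have /compact_near_coveringP nc := cantor_space_compact.
have : \forall n \near \oo, [set: cantor_space] `<=`
    (fun w => forall w' : cantor_space, mkseq w n = mkseq w' n -> `|f w - f w'| < e).
  apply: nc => w _.
  have /cvgrPdist_lt/(_ _ e2) := cf w; move=> /nbhs_cantorP[n0 fn0].
  exists (cyl n0 (mkseq w n0), [set n | (n0 <= n)%N]).
    by split=> /=; [apply/nbhs_cantorP; exists n0|exact: nbhs_infty_ge].
  move=> [w1 n] [/= w1w n0n] w2 w12.
  have w2w : mkseq w2 n0 = mkseq w n0 by rewrite -w1w; exact/esym/(eq_mkseq_le n0n).
  have := fn0 w1 w1w; have := fn0 w2 w2w; rewrite /= => h2 h1.
  rewrite (splitr e) -(subrKA (f w)) (le_lt_trans (ler_normD _ _))// ltrD//.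
  by rewrite distrC.
by move=> [N _ /(_ N (leqnn N)) H]; exists N => w w'; exact: H.
Qed.

Lemma measurable_continuous_boundary (f : cantor_space -> R) :
  continuous f -> measurable_fun setT (f : borel_boundary -> R).
Proof.
move=> /continuousP cf; apply: (measurability _ (RGenOpens.measurableE R)).
move=> _ [_ [x [y ->]] <-]; rewrite setTI.
by apply: measurable_open; apply: cf; exact: interval_open.
Qed.

Lemma integrable_orbit_point g w (f : bounded_continuous R) :
  (@unit_lebesgue R).-integrable setT (EFin \o (projT1 f \o orbit_point g w)).
Proof.
apply: measurable_bounded_integrable => //.
- by rewrite [X in (X < _)%E](@probability_setT _ _ _ (@unit_lebesgue R)) ltry.
- apply: measurableT_comp; last exact: measurable_orbit_point.
  by apply: measurable_continuous_boundary; case: (projT2 f).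
- have [_ [M [Mr fM]]] := projT2 f.
  by exists M; split=> // N MN x _; exact: (fM N MN).
Qed.

Lemma integrals_orbit_component g w (f : bounded_continuous R) :
  integrals (orbit_component R g w) f =
  \int[@unit_lebesgue R]_x (projT1 f (orbit_point g w x)).
Proof.
have mf : measurable_fun setT (projT1 f : borel_boundary -> R).
  by apply: measurable_continuous_boundary; case: (projT2 f).
rewrite /integrals /Rintegral; congr fine.
(* [null_off] alters values only on non-measurable sets, which does not affect integrals. *)
transitivity (\int[orbit_measure R g w]_x (projT1 f x)%:E)%E.
  by apply: eq_measure_integral => A mA _; rewrite /= null_offE.
rewrite integral_pushforward//=; first exact/measurable_EFinP.
exact: integrable_orbit_point.
Qed.

(** If [w] and [w'] share a prefix of length [n], so do their orbit points for every [x]; by uniform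
    continuity the integrands then differ by less than [e] everywhere. *)
Lemma orbit_component_continuous g (f : bounded_continuous R) :
  continuous (fun w => integrals (orbit_component R g w) f).
Proof.
move=> w; apply/cvgrPdist_le => e e0.
have cf : continuous (projT1 f) by case: (projT2 f).
have [n fn] := cantor_uniform_continuity cf e0.
apply/nbhs_cantorP; exists n => w' /= w'w.
rewrite !integrals_orbit_component -RintegralB//; try exact: integrable_orbit_point.
have icst : (@unit_lebesgue R).-integrable setT (EFin \o cst e).
  by apply: finite_measure_integrable_cst.
have idiff : (@unit_lebesgue R).-integrable setT
    (EFin \o (fun x => projT1 f (orbit_point g w x) - projT1 f (orbit_point g w' x))).
  have -> : EFin \o (fun x => projT1 f (orbit_point g w x) - projT1 f (orbit_point g
    w' x)) =
    ((EFin \o (projT1 f \o orbit_point g w)) \- (EFin \o (projT1 f \o orbit_point g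
      w')))%E by [].
  by apply: integrableB => //; exact: integrable_orbit_point.
apply: le_trans (le_normr_Rintegral _ _) _ => //.
have <- : \int[@unit_lebesgue R]_x (cst e x) = e.
  rewrite Rintegral_cst// [X in fine X](@probability_setT _ _ _ (@unit_lebesgue R)).
  by rewrite mulr1.
apply: le_Rintegral => //; first exact: (integrable_norm idiff).
move=> x _; apply/ltW/fn; rewrite !mkseq_orbit_point w'w//.
Qed.

End WeakTopology.

(** * Classification of ergodic measures by a coding of orbit closures *)

Section OrbitClassification.
Variables (R : realType) (g : tree_aut) (Phi s : cantor_space -> cantor_space).
Local Open Scope ring_scope.
Hypothesis Phi_local : local_fun Phi.
Hypothesis s_local : local_fun s.
Hypothesis Phi_orbit_equiv : forall w w', boundary_equiv g w w' -> Phi w = Phi w'.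
Hypothesis orbit_equiv_s_Phi : forall w, boundary_equiv g w (s (Phi w)).
Hypothesis sK : cancel s Phi.

Let digit_set n : set cantor_space := [set w | Phi w n].

Let indic_near (w : cantor_space) n :
  \forall w' \near w, (\1_(digit_set n) w' : R) = \1_(digit_set n) w.
Proof.
apply: filterS (local_fun_near Phi_local w n) => w' w'w.
rewrite !indicE; congr (_%:R); congr nat_of_bool.
by apply/idP/idP; rewrite !inE /digit_set /= w'w.
Qed.

Let open_digit_set n : open (digit_set n).
Proof.
rewrite openE => w wn; apply: filterS (local_fun_near Phi_local w n) => w' /= w'w.
by rewrite /digit_set /= w'w.
Qed.

Let measurable_digit_set n : measurable (digit_set n : set borel_boundary).
Proof. by apply: measurable_open; exact: open_digit_set. Qed.

Let digit_indic (n : nat) : bounded_continuous R.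
Proof.
exists (\1_(digit_set n)); split.
  move=> w; apply: cvg_near_cst; exact: indic_near.
exists 1; split=> // x x1 w _ /=; rewrite indicE.
by case: (_ \in _); rewrite ?normr0 ?normr1 ltW// (lt_trans _ x1).
Defined.

(** The almost sure value of [Phi]: each digit set is invariant, so by ergodicity it has measure 0
    or 1. *)
Definition component_label (mu : ergodic_space R (cyclic_gen g)) : cantor_space :=
  fun n => `[< projT1 mu (digit_set n) = 1%E >].

Let digit_set_01 (mu : ergodic_space R (cyclic_gen g)) n :
  projT1 mu (digit_set n) = (component_label mu n)%:R%:E.
Proof.
rewrite /component_label; case: asboolP => [//|mun].
have [_ erg _] := projT2 mu.
have [] // := erg (digit_set n) (measurable_digit_set n).
move=> h gh; apply/seteqP; split=> w; rewrite /digit_set /=.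
  by rewrite -(Phi_orbit_equiv (boundary_equiv_act w gh)).
by rewrite (Phi_orbit_equiv (boundary_equiv_act w gh)).
Qed.

(** Each digit of the label is the integral of a continuous indicator. Being 0 or 1, it is constant
    wherever it moves by less than 1. *)
Lemma component_label_continuous : continuous component_label.
Proof.
apply: continuous_cantor => mu n.
have intE (nu : ergodic_space R (cyclic_gen g)) :
    integrals nu (digit_indic n) = (component_label nu n)%:R.
  rewrite /integrals /= /Rintegral integral_indic//= setIT.
  by rewrite digit_set_01.
have := @continuous_integral R (cyclic_gen g) (digit_indic n) mu.
move=> /cvgrPdist_lt/(_ 1 ltr01); apply: filterS => nu /=.
rewrite !intE; do 2 case: component_label => //=.
  by rewrite subr0 normr1 ltxx.
by rewrite sub0r normrN normr1 ltxx.
Qed.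

Let component_supported (mu : ergodic_space R (cyclic_gen g)) :
  supported_on_orbit g (s (component_label mu)) (projT1 mu).
Proof.
move=> n v nv; apply: measure_negligible; first exact: measurable_cyl.
(* Each [B k] is null. Outside their union [Phi w] is the label, so [w] lies in the orbit closure of
   its image under [s], against the choice of [v]. *)
pose B k := [set w : borel_boundary | Phi w k != component_label mu k].
apply: (@negligibleS _ _ _ _ (\bigcup_k B k)) => [w wv|].
  apply: contrapT => nB; apply: nv.
  have <- : Phi w = component_label mu.
    apply/funext => k; apply/eqP; apply: contrapT => /negP kw; apply: nB.
    by exists k.
  by rewrite -[v]wv; exact: (boundary_equiv_sym (orbit_equiv_s_Phi w)).
apply: negligible_bigcup => k.
have := digit_set_01 mu k; rewrite /B; case: component_label => muk.
  have -> : [set w : borel_boundary | Phi w k != true] = ~` digit_set k.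
    by apply/seteqP; split=> w; rewrite /digit_set /= eqb_id => /negP.
  apply/negligibleP; first by apply: measurableC; exact: measurable_digit_set.
  transitivity (1 - projT1 mu (digit_set k))%E; first exact: probability_setC.
  by rewrite muk -EFinB subrr.
have -> : [set w : borel_boundary | Phi w k != false] = digit_set k.
  by apply/seteqP; split=> w; rewrite /digit_set /= eqbF_neg negbK.
by apply/negligibleP => //; exact: measurable_digit_set.
Qed.

Lemma component_labelK :
  cancel component_label (fun c => orbit_component R g (s c)).
Proof.
move=> mu; apply: ergodic_component_eq => A mA.
rewrite /= null_offE//.
apply: (@orbit_measure_unique R g (s (component_label mu))) => //.
- exact: orbit_measure_invariant.
- by apply: invariant_cyl; case: (projT2 mu).
- exact: orbit_measure_supported.
- transitivity (1 : \bar R)%E; first exact: probability_setT.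
  by apply/esym; exact: probability_setT.
- by rewrite [X in (X < _)%E](@probability_setT _ _ _ (orbit_measure R g _)) ltry.
Qed.

(** All orbit points of [s c] lie in the closure of its orbit, where [Phi] is constantly [c]; so
    each digit set pulls back to everything or to nothing. *)
Lemma component_label_orbit :
  cancel (fun c => orbit_component R g (s c)) component_label.
Proof.
move=> c; apply/funext => n.
suff : projT1 (orbit_component R g (s c)) (digit_set n) = (c n)%:R%:E.
  rewrite (digit_set_01 (orbit_component R g (s c))) => -[].
  by case: component_label; case: (c n) => // /eqP; rewrite ?oner_eq0// eq_sym oner_eq0.
rewrite /= null_offE//.
have E x : Phi (orbit_point g (s c) x) = c.
  rewrite -[RHS]sK; apply/Phi_orbit_equiv/boundary_equiv_sym => k.
  by rewrite mkseq_orbit_point; exists (digit_sum x k).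
rewrite /= /distribution /pushforward.
case cn : (c n).
  rewrite [X in unit_lebesgue X](_ : _ = setT); first exact: probability_setT.
  by apply/seteqP; split=> x // _; rewrite /digit_set /= E.
rewrite [X in unit_lebesgue X](_ : _ = set0) ?measure0//.
  by apply/seteqP; split=> x //; rewrite /digit_set /= E cn.
Qed.

Theorem ergodic_space_homeomorphic_cantor :
  homeomorphic (ergodic_space R (cyclic_gen g)) cantor_space.
Proof.
exists component_label, (fun c => orbit_component R g (s c)); split.
- exact: component_labelK.
- exact: component_label_orbit.
- exact: component_label_continuous.
apply: continuous_ergodic => f c.
apply: (@continuous_comp _ _ _ s (fun w => integrals (orbit_component R g w) f)).
  exact: local_fun_continuous.
exact: orbit_component_continuous.
Qed.

End OrbitClassification.

(** * Coding the closures of orbits *)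

(* [Phi] is a complete invariant of the closures of orbits, with section [s]. *)
Definition cantor_closures g : Prop :=
  exists Phi s : cantor_space -> cantor_space,
  [/\ local_fun Phi, local_fun s,
      forall w w', boundary_equiv g w w' -> Phi w = Phi w',
      forall w, boundary_equiv g w (s (Phi w)) & cancel s Phi].

Definition mersenne (i : nat) : Prop := exists k, i = (2 ^ k).-1.

Lemma non_mersenne_double i : ~ mersenne i.+1.*2.
Proof.
move=> [[|k]] //; rewrite expnS mul2n => /(congr1 succn).
rewrite prednK ?double_gt0 ?expn_gt0// => /(congr1 odd).
by rewrite /= !odd_double.
Qed.

(** The free positions form an infinite set, as they include all positive even numbers; [e]
    enumerates them and [d] inverts [e]. *)
Lemma non_mersenne_enum : exists e d : nat -> nat,
  [/\ forall j, ~ mersenne (e j), cancel e d & forall i, ~ mersenne i -> e (d i) = i].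
Proof.
have inf : infinite_set (~` mersenne).
  move=> fin; apply: infinite_nat.
  have -> : [set: nat] = (fun i => i.+1.*2) @^-1` (~` mersenne).
    by apply/seteqP; split=> i // _; exact: non_mersenne_double.
  by apply: finite_preimage fin => i j _ _ /double_inj[].
have /card_set_bijP[d [dfun dinj dsurj]] := eq_card_nat (countableP _) inf.
have /choice[e eP] : forall j, exists i, ~ mersenne i /\ d i = j.
  by move=> j; have [i ni <-] := dsurj j I; exists i.
exists e, d; split=> [j|j|i ni]; [by case: (eP j)|by case: (eP j)|].
by apply: dinj; rewrite ?inE; case: (eP (d i)).
Qed.

Definition boundary_normal_form (w : nat -> bool) : cantor_space :=
  fun i => nth false (normal_form (mkseq w i.+1)) i.

Lemma mkseq_boundary_normal_form w n :
  mkseq (boundary_normal_form w) n = normal_form (mkseq w n).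
Proof.
elim: n => [|n IH].
  by apply/esym/size0nil; rewrite size_normal_form.
rewrite !mkseqS; have [y yE] := normal_form_rcons (mkseq w n) (w n).
rewrite IH /boundary_normal_form mkseqS yE nth_rcons.
by rewrite size_normal_form size_mkseq ltnn eqxx.
Qed.

Lemma boundary_equiv_boundary_normal_form w :
  boundary_equiv a_aut w (boundary_normal_form w).
Proof. by move=> n; rewrite mkseq_boundary_normal_form;
  case: (normal_formP (mkseq w n)). Qed.

Lemma boundary_normal_form_mersenne w k : boundary_normal_form w (2 ^ k).-1 = false.
Proof. by rewrite /boundary_normal_form;
  case: (normal_formP (mkseq w (2 ^ k).-1.+1)). Qed.

Lemma boundary_normal_form_orbit_equiv w w' : boundary_equiv a_aut w w' ->
  boundary_normal_form w = boundary_normal_form w'.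
Proof.
by move=> ww'; apply/funext => i;
  rewrite /boundary_normal_form (orbit_equiv_normal_form (ww' i.+1)).
Qed.

Lemma boundary_normal_form_id w : (forall k, w (2 ^ k).-1 = false) ->
  boundary_normal_form w = w.
Proof.
move=> nw; apply/funext => i; rewrite /boundary_normal_form normal_form_id ?nth_mkseq//.
move=> k; have [ki|ik] := ltnP (2 ^ k).-1 i.+1; first by rewrite nth_mkseq.
by rewrite nth_default// size_mkseq.
Qed.

(** The code lists the letters of the normal form at the free positions; the section puts them back
    and fills the positions [(2 ^ k).-1] with [false]. *)
Lemma a_classification : cantor_closures a_aut.
Proof.
have [e [d [ne eK dK]]] := non_mersenne_enum.
exists (fun w j => boundary_normal_form w (e j)).
exists (fun c i => if `[< mersenne i >] then false else c (d i)).
split.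
- move=> j; exists (e j).+1 => w w' ww'.
  by rewrite /boundary_normal_form ww'.
- move=> i; exists (d i).+1 => w w' /eq_mkseqP ww'.
  by case: asboolP => // _; exact: ww'.
- by move=> w w' /boundary_normal_form_orbit_equiv ->.
- move=> w; set c := (X in boundary_equiv _ _ X).
  have -> : c = boundary_normal_form w; last exact: boundary_equiv_boundary_normal_form.
  apply/funext => i; rewrite /c; case: asboolP => [[k ->]|/dK ->//].
  by rewrite boundary_normal_form_mersenne.
- move=> c; apply/funext => j; rewrite boundary_normal_form_id.
    by rewrite asboolF// eK.
  by move=> k; rewrite asboolT//; exists k.
Qed.

(** The word is copied up to and including its first 1, and [Phi] is applied to what follows. The
    recursion runs on the output position, since the word may contain no 1. *)
Fixpoint b_label (Phi : cantor_space -> cantor_space)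
    (w : nat -> bool) (n : nat) : bool :=
  if n is m.+1 then
    (if w 0 then Phi else b_label Phi) (fun i => w i.+1) m
  else w 0.

Lemma boundary_equiv_b w w' : boundary_equiv b_aut w w' <->
  w 0 = w' 0 /\
  boundary_equiv (if w 0 then a_aut else b_aut) (fun i => w i.+1) (fun i => w' i.+1).
Proof.
split=> [ww'|[w0 ww'] [|n]]; last 2 first.
- exact: orbit_equiv_refl.
- by rewrite !mkseq_cons; apply/orbit_equiv_b_cons; eexists; rewrite -?w0.
have w0 : w 0 = w' 0.
  by have /orbit_equiv_b_cons[u] := ww' 1 => -[<-].
split=> // n; have := ww' n.+1; rewrite !mkseq_cons => /orbit_equiv_b_cons[u].
by move=> [_ <-].
Qed.

Lemma b_label_local Phi : local_fun Phi -> local_fun (b_label Phi).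
Proof.
move=> Pl; elim=> [|n [m mP]]; first by exists 1 => w w' /eq_mkseqP/(_ 0 isT).
have [k kP] := Pl n; exists (maxn m k).+1 => w w' ww' /=.
have /eq_mkseqP/(_ 0 isT) -> := ww'.
have tl : mkseq (fun i => w i.+1) (maxn m k) = mkseq (fun i => w' i.+1) (maxn m k).
  by move: ww'; rewrite !mkseq_cons => -[].
by case: (w' 0); [apply: kP|apply: mP]; apply: eq_mkseq_le tl;
  rewrite ?leq_maxl ?leq_maxr.
Qed.

(** The same construction turns the code for [a] into one for [b] and the section for [a] into a
    section for [b]. *)
Lemma b_classification : cantor_closures b_aut.
Proof.
have [Phi [s [Phil sl Phic sP sK]]] := a_classification.
exists (b_label Phi), (b_label s); split; try exact: b_label_local.
- move=> w w' ww'; apply/funext => n;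
  elim: n w w' ww' => [|n IH] w w' /boundary_equiv_b[w0 ww'] //=.
  by rewrite -w0; case: (w 0) ww' => [/Phic ->|/IH].
- move=> w n; elim: n w => [|n IH] w; first exact: orbit_equiv_refl.
  rewrite !mkseq_cons; apply/orbit_equiv_b_cons; eexists; first by [].
  by rewrite /=; case: (w 0); [exact: sP|exact: IH].
- move=> c; apply/funext => n; elim: n c => [//|n IH] c /=.
  by case: (c 0); [rewrite sK|rewrite IH].
Qed.

Lemma homeomorphic_cantor (R : realType) g :
  cantor_closures g ->
  homeomorphic (ergodic_space R (cyclic_gen g)) cantor_space.
Proof.
by move=> [Phi [s [h1 h2 h3 h4 h5]]];
  exact: (ergodic_space_homeomorphic_cantor R h1 h2 h3 h4 h5).
Qed.

Theorem theorem3p6 (R : realType) :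
  ((forall (n : nat) (O : set word),
      orbit_level (cyclic_gen a_aut) (2 ^ n - 1)%N O ->
      (orbit_children (cyclic_gen a_aut) O #= `I_1)%card) /\
   (forall (m : nat) (O : set word),
      (forall n : nat, m <> (2 ^ n - 1)%N) ->
      orbit_level (cyclic_gen a_aut) m O ->
      (orbit_children (cyclic_gen a_aut) O #= `I_2)%card) /\
   homeomorphic (ergodic_space R (cyclic_gen a_aut)) cantor_space) /\
  ((exists O0 O1 : set word,
      [/\ O0 <> O1,
          orbit_children (cyclic_gen b_aut)
            (rg_root (orbit_tree (cyclic_gen b_aut))) = [set O0; O1],
          rooted_isomorphic (orbit_subtree (cyclic_gen b_aut) O0)
            (orbit_tree (cyclic_gen b_aut)) &
          rooted_isomorphic (orbit_subtree (cyclic_gen b_aut) O1)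
            (orbit_tree (cyclic_gen a_aut))]) /\
   homeomorphic (ergodic_space R (cyclic_gen b_aut)) cantor_space).
Proof.
split; [split; [|split]|split].
- exact: orbit_children_a1.
- exact: orbit_children_a2.
- exact/homeomorphic_cantor/a_classification.
- exact: orbit_tree_b.
- exact/homeomorphic_cantor/b_classification.
Qed.
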